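(* Let $K$ be a field, $S=K[x_1,\ldots,x_n]$, and let $I\subset S$ be a transversal polymatroidal ideal. Then $I$ has a unique presentation (up to the order of the factors) of the form $$I=\prod_{j=1}^s P_{G_j}^{a_j},$$ where $G_1,\ldots,G_s$ are pairwise distinct non-empty subsets of $\{1,\ldots,n\}$ and $a_j\ge 1$ for all $j$.
   Context: For a non-empty subset $F\subset[n]=\{1,\ldots,n\}$, $P_F=(x_i : i\in F)$. A transversal polymatroidal ideal is an ideal of the form $I=P_{F_1}P_{F_2}\cdots P_{F_r}$, where $r\ge1$ and $F_1,\ldots,F_r$ is a collection of non-empty, not necessarily distinct, subsets of $[n]$. *)

(* Defs.v *)
From mathcomp Require Import all_boot all_algebra mpoly.
From mathcomp Require Import boolp classical_sets.

Set Implicit Arguments.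
Unset Strict Implicit.
Unset Printing Implicit Defensive.

Import GRing.Theory.
Local Open Scope ring_scope.
Local Open Scope classical_set_scope.

Section Ideals.
Variable R : comNzRingType.

(* Not necessarily proper, unlike [idealr_closed] in ring_quotient, and a
   [Prop]-valued predicate, since ideal membership need not be decidable. *)
Definition is_ideal (I : set R) : Prop :=
  [/\ I 0, forall x y, I x -> I y -> I (x + y) & forall a x, I x -> I (a * x)].

Definition ideal_gen (A : set R) : set R := smallest is_ideal A.

Definition idealM (I J : set R) : set R :=
  ideal_gen [set x | exists a b, [/\ I a, J b & x = a * b]].

(* The empty product is the unit ideal. *)
Definition idealX (I : set R) (a : nat) : set R := iter a (idealM I) [set: R].

End Ideals.

Section TransversalPolymatroidal.
Variables (K : fieldType) (n : nat).

(* The index set {1, ..., n} is encoded as 'I_n = {0, ..., n-1}. *)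
Definition P_ (F : {set 'I_n}) : set {mpoly K[n]} :=
  ideal_gen [set f | exists2 i : 'I_n, i \in F & f = 'X_i].

Definition transversal_polymatroidal (I : set {mpoly K[n]}) : Prop :=
  exists (r : nat) (F : 'I_r -> {set 'I_n}),
    [/\ (0 < r)%N, forall j, F j != finset.set0 &
        I = \big[@idealM {mpoly K[n]}/[set: {mpoly K[n]}]]_(j < r) P_ (F j)].

(* The list p = [:: (G_1, a_1); ...; (G_s, a_s)] encodes the expression
   P_{G_1}^{a_1} ... P_{G_s}^{a_s}; two lists encode the same expression up to
   the order of the factors exactly when they are related by [perm_eq]. *)
Definition is_presentation (I : set {mpoly K[n]})
    (p : seq ({set 'I_n} * nat)) : Prop :=
  [/\ (0 < size p)%N,
      uniq [seq Ga.1 | Ga <- p],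
      {in p, forall Ga, Ga.1 != finset.set0 /\ (0 < Ga.2)%N} &
      I = \big[@idealM {mpoly K[n]}/[set: {mpoly K[n]}]]_(Ga <- p)
            idealX (P_ Ga.1) Ga.2].

End TransversalPolymatroidal.

(* Main.v *)
(* For a list [s] of non-empty sets, the least degree in the variables [x_i],
   [i] in [A], of a monomial occurring in an element of the product of the
   [P_F], [F] in [s], is the number of [F] in [s] that are contained in [A]:
   each such [F] forces degree at least one, and every other factor offers a
   variable outside [A]. Hence the ideal determines these numbers for all [A],
   and Moebius inversion over the subset lattice recovers the multiplicity of
   each set in [s]. *)
Require Import Defs.
From HB Require Import structures.
From mathcomp Require Import all_boot all_algebra mpoly.
From mathcomp Require Import boolp classical_sets.

Set Implicit Arguments.
Unset Strict Implicit.
Unset Printing Implicit Defensive.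

Import GRing.Theory.

(** * Multiplication of ideals *)

Section IdealProduct.
Local Open Scope ring_scope.
Local Open Scope classical_set_scope.
Variable R : comNzRingType.
Implicit Types (A I J H : set R).

Lemma ideal_gen_ideal A : is_ideal (ideal_gen A).
Proof.
split=> [H [[]//]|x y Ax Ay H AH|a x Ax H AH]; have [[_ HD HM] _] := AH.
  by apply: HD; [exact: Ax | exact: Ay].
by apply: HM; exact: Ax.
Qed.

Lemma idealM_ideal I J : is_ideal (idealM I J).
Proof. exact: ideal_gen_ideal. Qed.

Lemma mem_idealM I J a b : I a -> J b -> idealM I J (a * b).
Proof. by move=> Ia Jb; apply: sub_gen_smallest; exists a, b. Qed.

Lemma idealM_sub I J H : is_ideal H ->
  (forall a b, I a -> J b -> H (a * b)) -> idealM I J `<=` H.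
Proof.
by move=> HH HM; apply: smallest_sub => // _ [a [b [Ia Jb ->]]]; exact: HM.
Qed.

Lemma idealMC : commutative (@idealM R).
Proof.
by move=> I J; apply/seteqP; split; apply: idealM_sub => [|a b Ia Jb];
  rewrite 1?mulrC; by [exact: idealM_ideal | exact: mem_idealM].
Qed.

(** This colon of [H] by [c] allows a containment with the factor [c] fixed to be tested on
    generators. *)
Lemma is_ideal_colon H c : is_ideal H -> is_ideal [set x | H (x * c)].
Proof.
case=> H0 HD HM; split=> /= [|x y Hx Hy|a x Hx]; first by rewrite mul0r.
  by rewrite mulrDl; exact: HD.
by rewrite -mulrA; exact: HM.
Qed.

Lemma idealMA : associative (@idealM R).
Proof.
have sub I J H : idealM (idealM I J) H `<=` idealM I (idealM J H).
  apply: idealM_sub => [|x c + Hc]; first exact: idealM_ideal.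
  move: x; apply: idealM_sub => [|a b Ia Jb /=].
    by apply: is_ideal_colon; exact: idealM_ideal.
  by rewrite -mulrA; apply: mem_idealM => //; exact: mem_idealM.
move=> I J H; apply/seteqP; split; last exact: sub.
(* Reversing every product by commutativity turns the other inclusion into [sub]. *)
by rewrite (idealMC J) (idealMC I) (idealMC _ H) (idealMC I); exact: sub.
Qed.

(** Only a semigroup law: [[set: R]] is neutral for ideals but not for arbitrary sets. Factors can
    still be reordered. *)
HB.instance Definition _ :=
  SemiGroup.isComLaw.Build (set R) (@idealM R) idealMA idealMC.

Lemma idealTM I : is_ideal I -> idealM [set: R] I = I.
Proof.
move=> HI; apply/seteqP; split=> [|x Ix].
  by apply: idealM_sub => // a b _; case: HI => _ _; apply.
by rewrite -(mul1r x); exact: mem_idealM.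
Qed.

Lemma big_idealM_ideal (T : Type) (s : seq T) (F : T -> set R) :
  is_ideal (\big[@idealM R/[set: R]]_(i <- s) F i).
Proof.
case: s => [|i s]; first by rewrite big_nil.
by rewrite big_cons; exact: idealM_ideal.
Qed.

Lemma iter_idealM I J a : is_ideal J ->
  iter a (idealM I) J = idealM (idealX I a) J.
Proof.
move=> HJ; elim: a => [|a IHa] /=; first by rewrite idealTM.
by rewrite IHa -idealMA.
Qed.

Lemma big_tally_seq (T : eqType) (F : T -> set R) (p : seq (T * nat)) :
  \big[@idealM R/[set: R]]_(i <- tally_seq p) F i =
  \big[@idealM R/[set: R]]_(q <- p) idealX (F q.1) q.2.
Proof.
elim: p => [|[x a] p IHp]; first by rewrite !big_nil.
rewrite big_cons -IHp -iter_idealM; last exact: big_idealM_ideal.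
by elim: a => //= a IHa; rewrite big_cons IHa.
Qed.

End IdealProduct.

Lemma sum_nat_eq1 (T : finType) (P : pred T) i : \sum_(j | P j) (i == j) = P i.
Proof.
rewrite big_mkcond (bigD1 i) //= eqxx big1 ?addn0 => [|j]; first by case: (P i).
by rewrite eq_sym => /negbTE->; case: ifP.
Qed.

Definition count_sub (T : finType) (A : {set T}) (s : seq {set T}) :=
  count (fun F : {set T} => F \subset A) s.

Definition prodP (K : fieldType) n (s : seq {set 'I_n}) : set {mpoly K[n]} :=
  (\big[@idealM {mpoly K[n]}/[set: {mpoly K[n]}]]_(F <- s) P_ F)%classic.
Arguments prodP K {n} s.

(** * Degree in the variables indexed by [A] *)

Section DegreeIn.
Variables (n : nat) (A : {set 'I_n}).
Implicit Types (m : 'X_{1.. n}) (s : seq {set 'I_n}).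

Definition mdeg_in m := \sum_(i in A) m i.

Lemma mdeg_inD m1 m2 : mdeg_in (m1 + m2)%MM = mdeg_in m1 + mdeg_in m2.
Proof. by rewrite -big_split; apply: eq_bigr => i _; rewrite mnmDE. Qed.

Lemma mdeg_in0 : mdeg_in 0%MM = 0.
Proof. by rewrite /mdeg_in big1 // => i _; rewrite mnm0E. Qed.

Lemma mdeg_in1 i : mdeg_in U_(i)%MM = (i \in A).
Proof.
by rewrite -(sum_nat_eq1 (mem A)); apply: eq_bigr => j _; rewrite mnm1E.
Qed.

Section OverField.
Variable K : fieldType.

(** This is the [k]-th power of the ideal generated by the variables indexed by [A]. *)
Definition order_ge k : set {mpoly K[n]} :=
  [set f | forall m, m \in msupp f -> k <= mdeg_in m]%classic.

Lemma order_geM k l (f g : {mpoly K[n]}) :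
  order_ge k f -> order_ge l g -> order_ge (k + l) (f * g)%R.
Proof.
move=> fk gl m /msuppM_le /allpairsP[[m1 m2] /= [m1f m2g ->]].
by rewrite mdeg_inD leq_add ?fk ?gl.
Qed.

Lemma order_ge_ideal k : is_ideal (order_ge k).
Proof.
split=> [m|f g fk gk m /msuppD_le|a f fk]; first by rewrite msupp0.
  by rewrite mem_cat => /orP[/fk|/gk].
by rewrite -(add0n k); apply: order_geM.
Qed.

(** The boolean serves as 0 or 1: if [F] lies in [A], every generator has degree one in [A];
    otherwise the bound is trivial. *)
Lemma P_sub_order_ge (F : {set 'I_n}) :
  (@P_ K n F `<=` order_ge (F \subset A))%classic.
Proof.
apply: smallest_sub => [|_ [i iF ->] m]; first exact: order_ge_ideal.
rewrite msuppX inE => /eqP->; rewrite mdeg_in1.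
by case: (boolP (F \subset A)) => // /fintype.subsetP->.
Qed.

Lemma prodP_sub_order_ge s :
  (prodP K s `<=` order_ge (count_sub A s))%classic.
Proof.
elim: s => [|F s IHs]; first by rewrite /prodP big_nil.
rewrite /prodP big_cons; apply: idealM_sub => [|f g fF gs].
  exact: order_ge_ideal.
by apply: order_geM; [exact: P_sub_order_ge | exact: IHs].
Qed.

Lemma ex_mdeg_in_prodP s : all (fun F => F != finset.set0) s ->
  exists2 m, mdeg_in m = count_sub A s &
    prodP K s 'X_[m]%R.
Proof.
elim: s => [_|F s IHs /= /andP[F0 /IHs[m <- sm]]].
  by exists 0%MM; rewrite ?mdeg_in0 // /prodP big_nil.
(* An index of [F] outside [A] is chosen if there is one, at no cost in degree; otherwise any index
   of the non-empty [F] costs one. *)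
have [i iF iA] : exists2 i, i \in F & (i \in A) = (F \subset A).
  have [FA|/fintype.subsetPn[i iF iA]] := boolP (F \subset A).
    by have /finset.set0Pn[i iF] := F0; exists i; rewrite ?(fintype.subsetP FA).
  by exists i => //; exact: negbTE.
exists (U_(i) + m)%MM; first by rewrite mdeg_inD mdeg_in1 iA.
rewrite /prodP big_cons mpolyXD; apply: mem_idealM => //.
by apply: sub_gen_smallest; exists i.
Qed.

End OverField.

End DegreeIn.

(** * Recovering the multiplicities from the ideal *)

Lemma count_subset_le (K : fieldType) n (A : {set 'I_n}) (s t : seq {set 'I_n}) :
  all (fun F => F != finset.set0) t -> prodP K s = prodP K t ->
  count_sub A s <= count_sub A t.
Proof.
move=> /(ex_mdeg_in_prodP A K)[m <- tm] st.
(* The monomial attaining the minimum for [t] lies in the product for [s], so the lower bound for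
   [s] applies to it. *)
apply: (@prodP_sub_order_ge _ A K s 'X_[m])%R.
  by rewrite st.
by rewrite msuppX inE.
Qed.

(** The counts are triangular for inclusion: [count_sub A] is the multiplicity of [A] plus those of
    its proper subsets, so induction on the size of [A] isolates the former. *)
Lemma perm_eq_count_subset (T : finType) (s t : seq {set T}) :
  (forall A : {set T}, count_sub A s = count_sub A t) -> perm_eq s t.
Proof.
move=> st; have countE u (A : {set T}) :
    count_sub A u = count_mem A u + \sum_(B : {set T} | B \proper A) count_mem B u.
  elim: u => [|F u IHu] /=; first by rewrite big1.
  rewrite -/(count_sub A u) IHu big_split /= addnACA; congr (_ + _).
  rewrite sum_nat_eq1 finset.subEproper; case: eqVneq => // ->.
  by rewrite fintype.properxx.
suff eqc k (A : {set T}) : #|A| < k -> count_mem A s = count_mem A t.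
  by apply/allP => A _; apply/eqP; exact: (eqc #|A|.+1).
elim: k A => // k IHk A Ak; have := st A; rewrite !countE.
rewrite (eq_bigr (fun B => count_mem B t)) => [/addIn//|B BA].
by apply: IHk; apply: leq_trans (proper_card BA) Ak.
Qed.

Lemma prodP_inj (K : fieldType) n (s t : seq {set 'I_n}) :
  all (fun F => F != finset.set0) s -> all (fun F => F != finset.set0) t ->
  prodP K s = prodP K t -> perm_eq s t.
Proof.
move=> s0 t0 st; apply: perm_eq_count_subset => A; apply/eqP.
by rewrite eqn_leq !(count_subset_le (K := K)).
Qed.

(** * Presentations as tallies *)

Lemma all_tally_seq (T : eqType) (a : pred T) (p : seq (T * nat)) :
  p \is a wf_tally T -> all a (tally_seq p) = all (fun q => a q.1) p.
Proof.
(* An entry of multiplicity zero would leave no trace in the expanded list; [wf_tally] excludes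
   it. *)
case/andP=> _; elim: p => //= -[x [|m]] p IHp; rewrite ?inE //= => /IHp <-.
by rewrite /tally_seq /= all_cat all_nseq; case: (a x); rewrite ?orbT ?orbF ?andbF.
Qed.

(** Distinct sets with positive exponents are exactly the well-formed tallies, so uniqueness can be
    checked on lists with repetition. *)
Lemma is_presentation_tally (K : fieldType) n (I : set {mpoly K[n]}) p :
  is_presentation I p <->
  [/\ p \is a wf_tally {set 'I_n}, 0 < size p,
      all (fun F => F != finset.set0) (tally_seq p) &
      I = prodP K (tally_seq p)].
Proof.
rewrite /prodP big_tally_seq; split=> [[p0 Up pP ->]|[wfp p0 + ->]].
  have wfp : p \is a wf_tally {set 'I_n}.
    by rewrite qualifE /= Up; apply/mapP => -[q /pP[_] +] q0; rewrite -q0.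
  by split=> //; rewrite all_tally_seq //; apply/allP => q /pP[].
rewrite all_tally_seq // => /allP pP; case/andP: wfp => Up Np.
split=> // q qp; split; first exact: pP.
by rewrite lt0n; apply: contraNneq Np => <-; exact: map_f.
Qed.

Theorem lemma3p1 (K : fieldType) (n : nat) (I : set {mpoly K[n]})
    (hI : transversal_polymatroidal I) :
  exists p : seq ({set 'I_n} * nat),
    is_presentation I p /\
    forall q : seq ({set 'I_n} * nat), is_presentation I q -> perm_eq p q.
Proof.
have [r [F [r0 F0 IE]]] := hI; pose s := [seq F j | j <- enum 'I_r].
have s0 : all (fun F => F != finset.set0) s.
  by rewrite all_map; apply/allP => j _; exact: F0.
have {}IE : I = prodP K s by rewrite /prodP big_map big_enum.
exists (tally s); split=> [|q /is_presentation_tally[wfq _ q0 qE]].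
  apply/is_presentation_tally; split; first exact: tallyP.
  (* An empty tally would come from an empty [s], against [0 < r]. *)
  - rewrite lt0n; apply: contraTneq r0 => /size0nil t0.
    have := perm_size (tallyK s).
    by rewrite t0 size_map size_enum_ord => <-.
  - by rewrite (perm_all _ (tallyK s)).
  - by rewrite IE; apply: perm_big; rewrite perm_sym tallyK.
(* A well-formed tally is recovered from its expansion, so it is enough to compare the expanded
   lists up to order. *)
rewrite -(tally_seqK wfq); apply: perm_tally.
by apply: (prodP_inj (K := K)) => //; rewrite -IE.
Qed.
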